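(* Let $r,\epsilon,R$ be positive real numbers. Let $G$ be a graph and $\mathcal{H}$ be a hypergraph with $V(G)=V(\mathcal{H})$ and $\mathrm{rank}(\mathcal{H})\le r$ such that $|f|\ge 3$ for every $f\in E(\mathcal{H})$. If either (1) $R\ge (1+\frac1\epsilon)r$ and $$a:=\Big\lceil \Delta(G)+R+(1+\epsilon)\cdot\max_{v\in V(G)}\Big\{d_{\mathcal{H}}(v)\cdot r^{\lceil \mathrm{mr}_{\mathcal{H}}(v)/2\rceil}R^{1-\lceil \mathrm{mr}_{\mathcal{H}}(v)/2\rceil}\Big\}\Big\rceil,$$ or (2) $r\le 4$ and $$a:=\big\lceil \Delta(G)+R+\Delta(\mathcal{H})\cdot(3R^{-1}+R^{-2})\big\rceil,$$ then for every $a$-assignment $L$ of $G$, there are at least $R^{|V(G)|}$ proper conflict-free $L$-colorings of $(G,\mathcal{H})$.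
   Context: Graphs and hypergraphs are finite, graphs are simple, and every edge of a hypergraph is a nonempty set of vertices (the edge set may be empty). $d_{\mathcal{H}}(v)$ is the number of edges of $\mathcal{H}$ containing $v$; $\Delta(G)$ and $\Delta(\mathcal{H})$ are the maximum degrees. The rank of $\mathcal{H}$ is $\mathrm{rank}(\mathcal{H})=\max_{f\in E(\mathcal{H})}|f|$ (with value $0$ if there are no edges), and $\mathrm{mr}_{\mathcal{H}}(v)=\min\{|f|: f\in E(\mathcal{H}),\ v\in f\}$. If $v$ lies in no edge of $\mathcal{H}$, the term $d_{\mathcal{H}}(v)\cdot r^{\lceil \mathrm{mr}_{\mathcal{H}}(v)/2\rceil}R^{1-\lceil \mathrm{mr}_{\mathcal{H}}(v)/2\rceil}$ is read as $0$. A coloring is a map $\varphi\colon V(G)\to\mathbb{Z}^+$. A proper conflict-free coloring of $(G,\mathcal{H})$ is a coloring that is proper on $G$ (adjacent vertices get different colors) and such that for every $f\in E(\mathcal{H})$ some color is used by $\varphi$ on exactly one vertex of $f$. An $a$-assignment $L$ assigns to each vertex $v$ a set $L(v)\subseteq\mathbb{Z}^+$ with $|L(v)|\ge a$; an $L$-coloring is a coloring with $\varphi(v)\in L(v)$ for all $v$. *)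

(* Defs.v *)
From mathcomp Require Import all_boot all_order all_algebra.
From mathcomp Require Import boolp classical_sets cardinality reals.

Set Implicit Arguments.
Unset Strict Implicit.
Unset Printing Implicit Defensive.

Import Order.TTheory GRing.Theory Num.Theory.

Local Open Scope ring_scope.

Record sgraph (V : finType) := SGraph {
  adj : rel V;
  adj_sym : symmetric adj;
  adj_irrefl : irreflexive adj
}.

Record hypergraph (V : finType) := Hypergraph {
  hedges : {set {set V}};
  hedges_neq0 : finset.set0 \notin hedges
}.

Section Degrees.
Variables (V : finType) (G : sgraph V) (H : hypergraph V).

Definition deg (v : V) : nat := #|[set u | adj G v u]%SET|.
Definition max_deg : nat := (\max_(v : V) deg v)%N.

Definition hdeg (v : V) : nat := #|[set f in hedges H | v \in f]%SET|.
Definition max_hdeg : nat := (\max_(v : V) hdeg v)%N.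

Definition hrank : nat := (\max_(f in hedges H) #|f|)%N.

(* The unit #|V| bounds every #|f|, so it does not affect the minimum when v
   lies in an edge; otherwise the value is junk. *)
Definition mr (v : V) : nat :=
  (\big[minn/#|V|]_(f in hedges H | v \in f) #|f|)%N.

(* [uphalf n] is the ceiling of n / 2.  If v lies in no edge, the factor
   [hdeg v] is 0, and so is the term whatever [mr v] is. *)
Definition hterm (K : realType) (r R : K) (v : V) : K :=
  (hdeg v)%:R * (r ^+ uphalf (mr v) * R ^ (1 - (uphalf (mr v))%:Z)).

(* For positive r and R every term is nonnegative, so 0 is neutral; it is the
   value of the maximum when V is empty. *)
Definition max_hterm (K : realType) (r R : K) : K :=
  \big[Num.max/0]_(v : V) hterm r R v.

End Degrees.

Notation color := {c : nat | (0 < c)%N}.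

Section Colorings.
Variables (V : finType) (G : sgraph V) (H : hypergraph V).

Definition proper_coloring (phi : {ffun V -> color}) : Prop :=
  forall u v : V, adj G u v -> phi u != phi v.

Definition conflict_free (phi : {ffun V -> color}) : Prop :=
  forall f : {set V}, f \in hedges H ->
    exists c : color, #|[set v in f | phi v == c]%SET| = 1%N.

Definition proper_conflict_free (phi : {ffun V -> color}) : Prop :=
  proper_coloring phi /\ conflict_free phi.

Definition L_coloring (L : V -> set color) (phi : {ffun V -> color}) : Prop :=
  forall v : V, L v (phi v).

End Colorings.

(* The cardinal of A, possibly infinite, is at least x. *)
Definition card_at_least (K : realType) (U : Type) (x : K) (A : set U) : Prop :=
  exists n : nat, x <= n%:R /\ (`I_n%classic #<= A)%card.

Definition assignment (K : realType) (V : finType) (a : K)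
    (L : V -> set color) : Prop :=
  forall v : V, card_at_least a (L v).

(* Main.v *)
Require Import Defs.
From mathcomp Require Import all_boot all_order all_algebra.

Set Implicit Arguments.
Unset Strict Implicit.
Unset Printing Implicit Defensive.

Import Order.TTheory GRing.Theory Num.Theory.

Local Open Scope ring_scope.

(** The proof is Rosenfeld's counting argument.  For a set S of vertices let
    N(S) be the number of list colorings of S that are proper on S and
    conflict-free on the edges contained in S.  It is shown by induction on S
    that N(S) >= R N(S - v) for every v in S; since N(empty) = 1, iterating
    this over all of V gives the bound R^|V|.

    Coloring v arbitrarily from L(v) after a good coloring of S - v gives at
    least |L(v)| N(S - v) extensions (card_extensions).  An extension that is
    not good gives v the color of a neighbor, which happens for at most
    deg(v) N(S - v) extensions, or leaves some edge f containing v, f inside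
    S, without a unique color (extensions_bound).  So it suffices to bound the
    number of extensions that spoil a given f by beta(v) N(S - v), with
    |L(v)| >= deg(v) + R + d_H(v) beta(v) (card_good_ge).

    The basic tool for this is determined_bound: if, in a family B of
    extensions, the colors on a set M containing v are determined by the colors
    on S - M, then |B| <= N(S - M), because restricting to S - M forgets
    nothing, and the induction hypothesis, applied |M| - 1 times below S - v,
    gives N(S - M) <= R^(1 - |M|) N(S - v).

    If f has no unique color, every vertex of f has a mate: another vertex of f
    of the same color.  Guess mates greedily, starting with v: while some vertex
    u of f is still unmatched, guess its mate u'; this makes the color of u
    determined, and takes u, and possibly u', off the list of unmatched
    vertices.  Each guess has fewer than |f| <= r outcomes and gains a factor R,
    and at least |f|/2 guesses are made, so when r <= R the number of
    extensions spoiling f is at most (r/R)^ceil(|f|/2) R N(S - v)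
    (conflicting_bound).  As |f| >= mr(v), this is at most the term of the
    maximum in case (1) without its factor d_H(v).

    In case (2) the edges have three or four vertices.  Once the mate u of v is
    guessed, at most two vertices remain, and no color being unique forces the
    color of one of them too; hence at most 3 guesses, each leaving at most
    R^-1 N(S - v) extensions (conflicting_bound_small). *)

(** * Partial colorings and their extensions *)

Lemma leq_card_bigcup (I T : finType) (P : pred I) (F : I -> {set T}) :
  (#|\bigcup_(i | P i) F i| <= \sum_(i | P i) #|F i|)%N.
Proof.
elim/big_rec2: _ => [|i n A _ le_A]; first by rewrite cards0.
by apply: leq_trans (leq_card_setU _ _) _; rewrite leq_add2l.
Qed.

Section PartialColorings.
Variables (V D : finType) (d : D) (G : sgraph V) (H : hypergraph V).
Variable L : V -> {set D}.
Implicit Types (S T M f : {set V}) (phi psi : {ffun V -> D}).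

(** A coloring of S is a total function with the default value d outside S, so
    that a partial coloring has exactly one representative; d may itself occur
    in the lists. *)
Definition restrict S phi : {ffun V -> D} :=
  [ffun x => if x \in S then phi x else d].

Definition list_coloring S phi : bool :=
  [forall x, if x \in S then phi x \in L x else phi x == d].

Definition proper_on S phi : bool :=
  [forall x in S, forall y in S, adj G x y ==> (phi x != phi y)].

Definition has_unique_color phi f : bool :=
  [exists x in f, forall y in f, (phi y == phi x) ==> (y == x)].

Definition good S : {set {ffun V -> D}} :=
  [set phi | [&& list_coloring S phi, proper_on S phi &
    [forall f in hedges H, (f \subset S) ==> has_unique_color phi f]]].

(** The edges and adjacencies at v are left unconstrained. *)
Definition extensions S v : {set {ffun V -> D}} :=
  [set phi | list_coloring S phi & restrict (S :\ v) phi \in good (S :\ v)].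

Lemma restrict_in S phi x : x \in S -> restrict S phi x = phi x.
Proof. by move=> xS; rewrite ffunE xS. Qed.

Lemma restrict_restrict S T phi :
  T \subset S -> restrict T (restrict S phi) = restrict T phi.
Proof.
move=> /subsetP TS; apply/ffunP=> x; rewrite !ffunE.
by case: ifP => // /TS ->.
Qed.

Lemma has_unique_color_eq phi psi f :
  {in f, phi =1 psi} -> has_unique_color phi f = has_unique_color psi f.
Proof.
move=> e; apply: eq_existsb => x; apply: andb_id2l => xf.
apply: eq_forallb => y; case: (boolP (y \in f)) => //= yf.
by rewrite !e.
Qed.

Lemma restrict_good S T phi :
  T \subset S -> phi \in good S -> restrict T phi \in good T.
Proof.
move=> sTS; have TS := subsetP sTS; rewrite !inE => /and3P[lS pS hS].
apply/and3P; split.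
- apply/forallP=> x; rewrite ffunE; case: (boolP (x \in T)) => // xT.
  by have := forallP lS x; rewrite (TS x xT).
- apply/forall_inP=> x xT; apply/forall_inP=> y yT; rewrite !restrict_in //.
  exact: (forall_inP (forall_inP pS x (TS _ xT)) y (TS _ yT)).
- apply/forall_inP=> f fH; apply/implyP=> fT.
  rewrite (@has_unique_color_eq _ phi).
    by apply: (implyP (forall_inP hS f fH)); apply: subset_trans sTS.
  by move=> x xf; rewrite restrict_in // (subsetP fT).
Qed.

Lemma no_unique_color phi f u : ~~ has_unique_color phi f -> u \in f ->
  exists2 u', u' \in f :\ u & phi u = phi u'.
Proof.
move=> nf uf; move: nf; rewrite negb_exists => /forallP /(_ u).
rewrite uf /= negb_forall => /existsP[w]; rewrite !negb_imply.
case/and3P=> wf /eqP e wu; exists w => //; by rewrite !inE wu.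
Qed.

(** Edges being nonempty, none lies inside the empty set. *)
Lemma card_good0 : #|good set0| = 1%N.
Proof.
apply/eqP/cards1P; exists [ffun => d]; apply/setP=> phi; rewrite !inE.
apply/idP/eqP => [/andP[/forallP l _]|->].
  by apply/ffunP=> x; have := l x; rewrite inE ffunE => /eqP.
apply/and3P; split.
- by apply/forallP=> x; rewrite inE ffunE.
- by apply/forall_inP=> x; rewrite inE.
- apply/forall_inP=> f fH; apply/implyP; rewrite subset0 => /eqP f0.
  by have := hedges_neq0 H; rewrite -f0 fH.
Qed.

Lemma card_extensions S v : v \in S ->
  (#|L v| * #|good (S :\ v)| <= #|extensions S v|)%N.
Proof.
move=> vS; rewrite -cardsX.
pose ext (p : D * {ffun V -> D}) : {ffun V -> D} :=
  [ffun x => if x == v then p.1 else p.2 x].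
have extK p : p.2 \in good (S :\ v) -> restrict (S :\ v) (ext p) = p.2.
  rewrite !inE => /andP[/forallP l _]; apply/ffunP=> x.
  have := l x; rewrite !ffunE !inE.
  by case: (x == v); case: (x \in S) => //= /eqP.
rewrite -(@card_in_imset _ _ ext).
  apply: subset_leq_card; apply/subsetP=> _ /imsetP[[c psi] + ->].
  rewrite inE /= => /andP[cL gpsi].
  rewrite inE (extK (c, psi)) // gpsi andbT.
  apply/forallP=> x; rewrite ffunE /=.
  have [->|xv] := eqVneq x v; first by rewrite vS.
  move: gpsi; rewrite inE => /andP[/forallP l _].
  by have := l x; rewrite !inE xv.
move=> [c psi] [c' psi']; rewrite !inE /= => /andP[_ g] /andP[_ g'] e.
congr pair.
  by have := congr1 (fun h : {ffun V -> D} => h v) e; rewrite !ffunE eqxx.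
have := extK (c, psi); have := extK (c', psi').
by rewrite !inE e /= => -> // ->.
Qed.

Definition determines (B : {set {ffun V -> D}}) S T :=
  forall phi psi, phi \in B -> psi \in B ->
    {in S, phi =1 psi} -> {in T, phi =1 psi}.

(** Restriction to S minus M is injective on B, and its values are good because
    they are restrictions of the good coloring of S minus v. *)
Lemma leq_card_good S v M (B : {set {ffun V -> D}}) :
  v \in M -> B \subset extensions S v -> determines B (S :\: M) S ->
  (#|B| <= #|good (S :\: M)|)%N.
Proof.
move=> vM /subsetP BE det.
rewrite -(@card_in_imset _ _ (restrict (S :\: M))).
  apply: subset_leq_card; apply/subsetP=> _ /imsetP[phi /BE phiE ->].
  have sub : S :\: M \subset S :\ v by rewrite setDS // sub1set.
  rewrite -(restrict_restrict _ sub); apply: restrict_good sub _.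
  by move: phiE; rewrite inE => /andP[].
move=> phi psi phiB psiB e; apply/ffunP=> x.
have [xS|xS] := boolP (x \in S).
  apply: det xS => // y yS.
  by rewrite -(restrict_in phi yS) e restrict_in.
have off chi : chi \in B -> chi x = d.
  move/BE; rewrite inE => /andP[/forallP l _]; apply/eqP.
  by have := l x; rewrite (negPf xS).
by rewrite !off.
Qed.

(** Whatever does not involve v is already taken care of on S minus v. *)
Lemma extension_not_good S v phi :
  phi \in extensions S v -> phi \notin good S ->
  (exists u, [/\ adj G v u, u \in S & phi v = phi u]) \/
  (exists f, [/\ f \in hedges H, v \in f, f \subset S &
                 ~~ has_unique_color phi f]).
Proof.
rewrite inE => /andP[lS gv] ng; move: gv; rewrite inE => /and3P[_ pv hv].
move: ng; rewrite inE lS /= negb_and => /orP[|].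
  rewrite negb_forall_in => /exists_inP[x xS].
  rewrite negb_forall_in => /exists_inP[y yS]; rewrite negb_imply negbK.
  case/andP=> xy /eqP e; left.
  have [xv|xv] := eqVneq x v; first by exists y; rewrite -xv.
  have [yv|yv] := eqVneq y v.
    by exists x; rewrite -yv (adj_sym G) xy e.
  have xI : x \in S :\ v by rewrite !inE xv.
  have yI : y \in S :\ v by rewrite !inE yv.
  have := implyP (forall_inP (forall_inP pv x xI) y yI) xy.
  by rewrite !restrict_in // e eqxx.
rewrite negb_forall_in => /exists_inP[f fH]; rewrite negb_imply.
case/andP=> fS nf; right; exists f; split=> //; apply: contraNT nf => vf.
have fSv : f \subset S :\ v by rewrite subsetD1 fS.
rewrite -(@has_unique_color_eq (restrict (S :\ v) phi)).
  exact: (implyP (forall_inP hv f fH)).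
by move=> x xf; rewrite restrict_in // (subsetP fSv).
Qed.

Definition conflicting S v f : {set {ffun V -> D}} :=
  [set phi in extensions S v | ~~ has_unique_color phi f].

(** An extension that gives v the color of a fixed neighbor is determined by its
    restriction to S minus v, whence the factor deg G v. *)
Lemma extensions_bound S v : v \in S ->
  (#|extensions S v| <= #|good S| + deg G v * #|good (S :\ v)|
     + \sum_(f in hedges H | (v \in f) && (f \subset S))
         #|conflicting S v f|)%N.
Proof.
move=> vS.
pose clash u := [set phi in extensions S v | (u \in S) && (phi v == phi u)].
have sub : extensions S v \subset good S
    :|: \bigcup_(u | adj G v u) clash u
    :|: \bigcup_(f in hedges H | (v \in f) && (f \subset S)) conflicting S v f.
  apply/subsetP=> phi phiE; rewrite !in_setU.
  have [//|nphi] := boolP (phi \in good S).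
  case: (extension_not_good phiE nphi) => [[u [vu uS e]]|[f [fH vf fS nf]]].
    apply/orP; left; apply/bigcupP; exists u => //.
    by rewrite inE phiE uS e eqxx.
  apply/orP; right; apply/bigcupP; exists f; first by rewrite fH vf.
  by rewrite inE phiE.
apply: leq_trans (subset_leq_card sub) _.
apply: leq_trans (leq_card_setU _ _) _.
apply: leq_add (leq_card_bigcup _ _).
apply: leq_trans (leq_card_setU _ _) _; rewrite leq_add2l.
apply: leq_trans (leq_card_bigcup _ _) _.
have -> : deg G v = #|[pred u | adj G v u]| by apply: eq_card => u; rewrite inE.
rewrite -sum_nat_const leq_sum // => u vu.
apply: (@leq_card_good S v); first by rewrite inE.
  by apply/subsetP=> phi; rewrite inE => /andP[].
move=> phi psi; rewrite !inE => /and3P[_ uS /eqP e1] /and3P[_ _ /eqP e2] e x xS.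
have uv : u != v.
  by apply: contraTneq vu => ->; rewrite (adj_irrefl G).
have eu : phi u = psi u by apply: e; rewrite !inE uv.
have [->|xv] := eqVneq x v; first by rewrite e1 e2.
by apply: e; rewrite !inE xv.
Qed.

(** * Counting the extensions that spoil an edge *)

Section Growth.
Variables (K : realFieldType) (R : K).
Hypothesis R_gt0 : 0 < R.

(** The inequality proved by induction, for S and everything below it. *)
Definition grows S : Prop :=
  forall T u, T \subset S -> u \in T ->
    R * #|good (T :\ u)|%:R <= #|good T|%:R.

(** The growth inequality is applied once per vertex of T. *)
Lemma grows_setD S T : grows S -> T \subset S ->
  R ^+ #|T| * #|good (S :\: T)|%:R <= #|good S|%:R.
Proof.
move=> gS; move en: #|T| => n; elim: n T en => [|n IHn] T cT TS.
  by rewrite (cards0_eq cT) setD0 mul1r.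
have /card_gt0P[u uT] : (0 < #|T|)%N by rewrite cT.
have cTu : #|T :\ u| = n by move: cT; rewrite (cardsD1 u) uT => -[].
have TuS : T :\ u \subset S by apply: subset_trans TS; rewrite subD1set.
apply: le_trans (IHn _ cTu TuS).
have -> : S :\: T = (S :\: (T :\ u)) :\ u.
  apply/setP=> x; rewrite !inE.
  by have [->|_] := eqVneq x u; rewrite ?uT //=.
rewrite exprSr -mulrA ler_wpM2l ?exprn_ge0 ?(ltW R_gt0) //.
by apply: gS; rewrite ?subsetDl // !inE eqxx (subsetP TS).
Qed.

Section OneEdge.
Variables (S : {set V}) (v : V) (f : {set V}).
Hypotheses (growsSv : grows (S :\ v)) (fS : f \subset S).

Local Notation bound := (R * #|good (S :\ v)|%:R).

(** Removing v costs nothing, since the comparison is with S minus v; each of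
    the #|M| - 1 other vertices of M gains a factor R. *)
Lemma determined_bound M (B : {set {ffun V -> D}}) :
  v \in M -> M \subset S -> B \subset extensions S v ->
  determines B (S :\: M) S -> #|B|%:R * R ^+ #|M| <= bound.
Proof.
move=> vM MS BE det; rewrite (cardsD1 v) vM exprS mulrC -mulrA.
rewrite ler_pM2l //.
have MvS : M :\ v \subset S :\ v by rewrite setSD.
apply: le_trans (grows_setD growsSv MvS).
rewrite ler_wpM2l ?exprn_ge0 ?(ltW R_gt0) //.
have -> : (S :\ v) :\: (M :\ v) = S :\: M.
  apply/setP=> x; rewrite !inE.
  by have [->|_] := eqVneq x v; rewrite ?vM //=.
by rewrite ler_nat (leq_card_good vM BE det).
Qed.

(** One step of the matching process.  M is the set of vertices whose color is
    known to be determined, I the set of vertices that are still unmatched.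
    The invariant is that the colors outside M and I determine those on M: I is
    kept out of the premise, so that a vertex of I may be added to M later
    without making the determination circular. *)
Lemma determines_step (M I : {set V}) (B : {set {ffun V -> D}}) u u' :
  [disjoint I & M] -> u \in I -> u' \in f :\ u ->
  {in B, forall phi, phi u = phi u'} ->
  determines B (S :\: (M :|: I)) (S :\: I) ->
  determines B (S :\: ((u |: M) :|: (I :\ u :\ u'))) (S :\: (I :\ u :\ u')).
Proof.
move=> IM uI; rewrite !inE => /andP[u'u u'f] Bu det phi psi phiB psiB e x.
have u'S := subsetP fS _ u'f.
have detI : {in S :\: I, phi =1 psi}.
  apply: det => // y; rewrite !inE !negb_or => /andP[/andP[yM yI] yS].
  apply: e; rewrite !inE !negb_or yM yS (negPf yI) !andbF !andbT /=.
  by apply: contraNneq yI => ->.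
have e' : phi u' = psi u'.
  have [u'I|u'I] := boolP (u' \in I); last by apply: detI; rewrite !inE u'I.
  by apply: e; rewrite !inE eqxx (negPf u'u) (disjointFr IM u'I) u'S.
rewrite !inE !negb_and !negbK => /andP[xI xS].
have [->//|xu'] := eqVneq x u'.
have [->|xu] := eqVneq x u; first by rewrite !Bu.
by apply: detI; move: xI; rewrite !inE (negPf xu) (negPf xu') /= => ->.
Qed.

(** The number of extensions compatible with the mates guessed so far.  The
    exponent of x survives the induction because a guess removes one or two
    vertices from I, hence lowers uphalf #|I| by at most one, and x <= 1.  The
    set M never loses a vertex, and at least one guess puts v into it. *)
Lemma conflicting_matching_bound (x : K) (M I : {set V})
    (B : {set {ffun V -> D}}) :
  0 <= x -> x <= 1 -> #|f|%:R <= x * R ->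
  [disjoint I & M] -> M :|: I \subset f -> v \in M :|: I ->
  B \subset conflicting S v f ->
  determines B (S :\: (M :|: I)) (S :\: I) ->
  #|B|%:R * R ^+ #|M| <= x ^+ uphalf #|I| * bound.
Proof.
move=> x0 x1 fxR; have [n cI] := ubnP #|I|.
elim: n => // n IHn in M I B cI *; move=> IM MIf vMI BC det.
have MS : M \subset S.
  by apply: subset_trans fS; apply: subset_trans MIf; apply: subsetUl.
have BE : B \subset extensions S v.
  by apply: subset_trans BC _; apply/subsetP=> phi; rewrite inE => /andP[].
have [I0|/set0Pn[w wI]] := eqVneq I set0.
  move: vMI det; rewrite I0 cards0 mul1r setU0 setD0 => vM.
  exact: determined_bound.
(* The vertex v is matched first, so that it is never just used up as a mate. *)
pose u := if v \in I then v else w.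
have uI : u \in I by rewrite /u; case: ifP.
have uf : u \in f by rewrite (subsetP MIf) // inE uI orbT.
have uM : u \notin M by rewrite (disjointFr IM uI).
have vM' : v \in u |: M.
  rewrite !inE /u; move: vMI; rewrite inE.
  by case: ifP; rewrite ?eqxx // orbF => _ ->; rewrite orbT.
pose Bu u' := [set phi in B | phi u == phi u'].
have cover : B \subset \bigcup_(u' in f :\ u) Bu u'.
  apply/subsetP=> phi phiB; move: (subsetP BC _ phiB); rewrite inE.
  case/andP=> _ /no_unique_color /(_ uf)[u' u'f e].
  by apply/bigcupP; exists u' => //; rewrite inE phiB e eqxx.
have cardB : #|B|%:R <= \sum_(u' in f :\ u) #|Bu u'|%:R :> K.
  rewrite -natr_sum ler_nat; apply: leq_trans (leq_card_bigcup _ _).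
  exact: subset_leq_card.
have I_gt0 : (0 < #|I|)%N by rewrite (cardsD1 u) uI.
have BuP u' : u' \in f :\ u ->
    #|Bu u'|%:R * R ^+ #|M|.+1 <= x ^+ (uphalf #|I|).-1 * bound.
  move=> u'f; set I' := I :\ u :\ u'.
  have cI' : (#|I'| < #|I| <= #|I'|.+2)%N.
    rewrite (cardsD1 u I) uI (cardsD1 u' (I :\ u)) -/I'.
    by case: (u' \in _); rewrite ?add0n ?add1n !ltnS leqnn ?leqnSn.
  case/andP: cI' => ltI leI.
  have -> : #|M|.+1 = #|u |: M| by rewrite cardsU1 uM.
  have I'I : I' \subset I by exact: subset_trans (subD1set _ _) (subD1set _ _).
  apply: le_trans (IHn (u |: M) I' (Bu u') _ _ _ _ _ _) _.
  - exact: leq_trans ltI cI.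
  - rewrite disjoint_subset; apply/subsetP=> y; rewrite !inE.
    by case/and3P=> _ /negPf-> yI; rewrite (disjointFr IM yI).
  - rewrite -setUA subUset sub1set uf; apply: subset_trans MIf.
    by rewrite setUS.
  - by rewrite inE vM'.
  - by apply: subset_trans BC; apply/subsetP=> phi; rewrite inE => /andP[].
  - apply: determines_step => //.
      by move=> phi; rewrite inE => /andP[_ /eqP].
    move=> phi psi; rewrite !inE => /andP[phiB _] /andP[psiB _].
    exact: det.
  - rewrite ler_wpM2r ?mulr_ge0 ?(ltW R_gt0) //.
    apply: ler_wiXn2l => //; rewrite -subn1 leq_subLR add1n.
    exact: (uphalf_leq leI).
rewrite -(ler_pM2r R_gt0) -mulrA -exprSr.
apply: le_trans (ler_wpM2r _ cardB) _; first by rewrite exprn_ge0 // ltW.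
rewrite mulr_suml; apply: le_trans (ler_sum _ BuP) _.
rewrite sumr_const -[leLHS]mulr_natl.
have -> : x ^+ uphalf #|I| = x * x ^+ (uphalf #|I|).-1.
  by rewrite -exprS prednK // uphalf_gt0.
rewrite -(mulrA x) [leRHS]mulrAC; apply: ler_wpM2r.
  by rewrite !mulr_ge0 ?exprn_ge0 ?ler0n ?(ltW R_gt0).
apply: le_trans fxR; rewrite ler_nat subset_leq_card ?subD1set //.
Qed.

Lemma conflicting_bound (x : K) :
  0 <= x -> x <= 1 -> #|f|%:R <= x * R -> v \in f ->
  #|conflicting S v f|%:R <= x ^+ uphalf #|f| * bound.
Proof.
move=> x0 x1 fxR vf.
have := @conflicting_matching_bound x set0 f (conflicting S v f) x0 x1 fxR.
rewrite cards0 mulr1 set0U => -> //.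
by rewrite disjoint_sym disjoints_subset sub0set.
Qed.

(** Let u be the mate of v.  At most two vertices w, t of f remain, and w gets
    the color of some known vertex: if w is alone, its mate is v or u; if not,
    w and t have the same color, for otherwise each would share the color of v
    and u, and they would agree after all.  So the colors of v and w are
    determined for each of the at most three choices of u. *)
Lemma conflicting_bound_small :
  (3 <= #|f| <= 4)%N -> v \in f ->
  #|conflicting S v f|%:R <= 3 * R^-1 * #|good (S :\ v)|%:R.
Proof.
move=> /andP[f3 f4] vf.
pose Bu u := [set phi in conflicting S v f | phi v == phi u].
have cover : conflicting S v f \subset \bigcup_(u in f :\ v) Bu u.
  apply/subsetP=> phi phiB; have := phiB; rewrite inE.
  case/andP=> _ /no_unique_color /(_ vf)[u uf e].
  by apply/bigcupP; exists u => //; rewrite inE phiB e eqxx.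
have BuP u : u \in f :\ v -> #|Bu u|%:R <= R^-1 * #|good (S :\ v)|%:R.
  move=> uf; set g := f :\ v :\ u.
  have cg : #|f| = #|g|.+2 by rewrite (cardsD1 v) vf (cardsD1 u) uf.
  have uv : u != v by move: uf; rewrite !inE => /andP[].
  have [w wg] : exists w, w \in g.
    by apply/set0Pn; rewrite -card_gt0; move: f3; rewrite cg.
  have /and3P[wu wv wf] : [&& w != u, w != v & w \in f].
    by move: wg; rewrite !inE.
  have [t /and3P[tw tv tf] Bt] : exists2 t, [&& t != w, t != v & t \in f] &
      {in Bu u, forall phi, phi w = phi t}.
    (* The vertex t that w copies is the same for all colorings in Bu u. *)
    have nocol phi y : phi \in Bu u -> y \in f ->
        exists2 z, z \in f :\ y & phi y = phi z.
      by rewrite !inE => /andP[/andP[_ nf] _]; apply: no_unique_color.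
    have inf phi z : phi \in Bu u -> z \in f -> phi z = phi u \/ z \in g.
      rewrite inE => /andP[_ /eqP e] zf.
      have [->|zv] := eqVneq z v; first by left.
      have [->|zu] := eqVneq z u; first by left.
      by right; rewrite !inE zu zv.
    have [gw|/subsetPn[t tg]] := boolP (g \subset [set w]).
      exists u; first by rewrite eq_sym wu uv; move: uf; rewrite inE => /andP[].
      move=> phi phiB; have [z zf e] := nocol phi w phiB wf.
      move: zf; rewrite in_setD1 => /andP[zw zf]; rewrite e.
      have [//|zg] := inf phi z phiB zf.
      by have := subsetP gw z zg; rewrite inE (negPf zw).
    rewrite inE => tw.
    have gwt z : z \in g -> z = w \/ z = t.
      suff /eqP <- : [set w; t] == g.
        by rewrite !inE => /orP[]/eqP; [left|right].
      rewrite eqEcard subUset !sub1set wg tg cards2 (eq_sym w) tw.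
      by move: f4; rewrite cg.
    have tf : [&& t != w, t != v & t \in f].
      by move: tg; rewrite !inE tw => /and3P[_ -> ->].
    exists t => // phi phiB.
    have [z] := nocol phi w phiB wf; rewrite in_setD1 => /andP[zw zf] ez.
    have {}ez : phi w = phi u \/ phi w = phi t.
      rewrite ez.
      have [->|/gwt[zw'|->]] := inf phi z phiB zf; try by [left|right].
      by rewrite zw' eqxx in zw.
    case: ez => // ew.
    have [y] := nocol phi t phiB (andP (proj2 (andP tf))).2.
    rewrite in_setD1 => /andP[yt yf] ->.
    have [->|/gwt[->|yt']] := inf phi y phiB yf; rewrite ?ew //.
    by rewrite yt' eqxx in yt.
  have wM : w \notin [set v] by rewrite inE.
  have uf' : u \in f by move: uf; rewrite inE => /andP[].
  have := @determined_bound (w |: [set v]) (Bu u).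
  rewrite cardsU1 wM cards1 -ler_pdivlMr ?exprn_gt0 // => le.
  apply: le_trans (le _ _ _ _) _.
  - by rewrite !inE eqxx orbT.
  - by rewrite subUset !sub1set !(subsetP fS).
  - by apply/subsetP=> phi; rewrite !inE => /andP[/andP[]].
  - move=> phi psi phiB psiB e.
    have ev : phi v = psi v.
      have := phiB; have := psiB.
      rewrite !inE => /andP[_ /eqP->] /andP[_ /eqP->].
      by apply: e; rewrite !inE negb_or (eq_sym u) wu uv (subsetP fS).
    have ew : phi w = psi w.
      by rewrite !Bt //; apply: e; rewrite !inE negb_or tw tv (subsetP fS).
    move=> y yS; have [->//|yv] := eqVneq y v; have [->//|yw] := eqVneq y w.
    by apply: e; rewrite !inE negb_or yv yw.
  by rewrite expr2 invfM mulrACA divff ?gt_eqF // mul1r mulrC.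
apply: le_trans (_ : \sum_(u in f :\ v) #|Bu u|%:R <= _).
  rewrite -natr_sum ler_nat; apply: leq_trans (leq_card_bigcup _ _).
  exact: subset_leq_card.
apply: le_trans (ler_sum _ BuP) _.
rewrite sumr_const -[leLHS]mulr_natl -mulrA.
apply: ler_wpM2r; first by rewrite mulr_ge0 ?invr_ge0 ?ler0n ?(ltW R_gt0).
by rewrite ler_nat -ltnS; move: f4; rewrite (cardsD1 v) vf.
Qed.

End OneEdge.
(** The induction on S.  The local bound on conflicting colorings is assumed
    only where the growth inequality holds below S minus v, which is what the
    induction provides. *)
Lemma card_good_ge (beta : V -> K) :
  (forall v, 0 <= beta v) ->
  (forall S v f, f \in hedges H -> v \in f -> f \subset S -> grows (S :\ v) ->
     #|conflicting S v f|%:R <= beta v * #|good (S :\ v)|%:R) ->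
  (forall v, (deg G v)%:R + R + (hdeg H v)%:R * beta v <= #|L v|%:R) ->
  R ^+ #|V| <= #|good setT|%:R.
Proof.
move=> beta_ge0 conflict_le L_ge.
have growth S : grows S.
  have [n cS] := ubnP #|S|; elim: n => // n IHn in S cS * => T u TS uT.
  have gTu : grows (T :\ u).
    apply: IHn; rewrite -ltnS; apply: leq_trans cS; rewrite ltnS.
    by apply: leq_trans (subset_leq_card TS); rewrite [leqRHS](cardsD1 u) uT.
  set N := #|good (T :\ u)|%:R : K.
  have := leq_trans (card_extensions uT) (extensions_bound uT).
  rewrite -(ler_nat K) !natrD !natrM natr_sum -/N => le1.
  have le2 : \sum_(f in hedges H | (u \in f) && (f \subset T))
      #|conflicting T u f|%:R <= (hdeg H u)%:R * beta u * N.
    rewrite /hdeg -mulrA mulr_natl -sumr_const.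
    under [leRHS]eq_bigl do rewrite inE.
    rewrite [leRHS](bigID (fun f => f \subset T)) /=.
    rewrite -[leLHS]addr0; apply: lerD.
      under [leRHS]eq_bigl do rewrite -andbA.
      by apply: ler_sum => f /and3P[fH uf fT]; apply: conflict_le.
    by apply: sumr_ge0 => f _; rewrite mulr_ge0 ?beta_ge0 ?ler0n.
  have le3 := ler_wpM2r (ler0n K #|good (T :\ u)|) (L_ge u).
  rewrite -/N !mulrDl in le3.
  have := le_trans le3 (le_trans le1 (lerD (lexx _) le2)).
  by rewrite lerD2r addrC lerD2r.
have := grows_setD (growth setT) (subxx _).
by rewrite setDv card_good0 mulr1 cardsT.
Qed.

End Growth.
End PartialColorings.

(** * From finite lists to arbitrary color sets *)

From mathcomp Require Import finmap.
From mathcomp Require Import boolp classical_sets cardinality reals.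

(** Both the lists and the set of colorings may be infinite; only finitely many
    of their elements are ever counted. *)
Lemma card_at_least_seqP (K : realType) (T : choiceType) (x : K) (A : set T) :
  card_at_least x A <->
  exists s : seq T, [/\ uniq s, {in s, forall y, A y} & x <= (size s)%:R].
Proof.
split=> [[n [xn /card_subP[C Cn CA]]]|[s [us sA xs]]].
  have Cf : finite_set C by apply/finite_setP; exists n.
  exists (enum_fset (fset_set C)); rewrite (card_fset_set Cn).
  split=> [|y yC|//]; first exact: fset_uniq.
  by apply: CA; move: yC; rewrite in_fset_set // inE.
exists (size s); split=> //; apply/card_subP.
exists [set` seq_fset tt s]%classic => [|y]; last first.
  by move=> ys; apply: sA; rewrite -(seq_fsetE tt).
by apply/card_eq_fsetP; rewrite size_seq_fset undup_id.
Qed.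

Section Transfer.
Variables (V : finType) (G : sgraph V) (H : hypergraph V).
Variables (s : seq color) (d : seq_sub s) (L : V -> {set seq_sub s}).

Definition color_of (phi : {ffun V -> seq_sub s}) : {ffun V -> color} :=
  [ffun x => ssval (phi x)].

Lemma color_of_inj : injective color_of.
Proof.
move=> phi psi e; apply/ffunP=> x; apply: val_inj.
by have := congr1 (fun h : {ffun V -> color} => h x) e; rewrite !ffunE.
Qed.

Lemma color_of_good phi : phi \in good d G H L [set: V] ->
  proper_conflict_free G H (color_of phi) /\ (forall x, phi x \in L x).
Proof.
rewrite inE => /and3P[/forallP lP pP hP]; split; last first.
  by move=> x; have := lP x; rewrite inE.
split=> [u v uv|f fH].
  rewrite !ffunE (inj_eq val_inj).
  have := forall_inP (forall_inP pP u (finset.in_setT u)) v (finset.in_setT v).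
  by rewrite uv.
have := forall_inP hP f fH; rewrite finset.subsetT /= => /exists_inP[x xf ux].
exists (color_of phi x); apply/eqP/cards1P; exists x; apply/setP=> y.
rewrite !inE !ffunE (inj_eq val_inj).
apply/andP/eqP => [[yf]|->]; last by rewrite xf eqxx.
by move/(implyP (forall_inP ux y yf))/eqP.
Qed.

End Transfer.

Lemma mr_le_card (V : finType) (H : hypergraph V) v (f : {set V}) :
  f \in hedges H -> v \in f -> (mr H v <= #|f|)%N.
Proof.
move=> fH vf; rewrite /mr -minEnat -leEnat.
by apply: bigmin_le_cond; rewrite fH.
Qed.

(** The lists L v are cut down to finite lists that are long enough; the finite
    palette is the union of these lists, with one more color as the default
    value of partial colorings. *)
Lemma proper_conflict_free_colorings (K : realType) (R : K) (R_gt0 : 0 < R)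
    (V : finType) (G : sgraph V) (H : hypergraph V) (beta : V -> K)
    (L : V -> set color) :
  (forall v, 0 <= beta v) ->
  (forall (D : finType) (d : D) (L' : V -> {set D})
     (S : {set V}) (v : V) (f : {set V}),
     f \in hedges H -> v \in f -> f \subset S ->
     grows d G H L' R (S :\ v)%SET ->
     #|conflicting d G H L' S v f|%:R
       <= beta v * #|good d G H L' (S :\ v)%SET|%:R) ->
  (forall v, card_at_least ((deg G v)%:R + R + (hdeg H v)%:R * beta v) (L v)) ->
  card_at_least (R ^+ #|V|)
    [set phi | proper_conflict_free G H phi /\ L_coloring L phi]%classic.
Proof.
move=> beta_ge0 conflict_le L_ge.
have /fin_all_exists[l lP] v := (card_at_least_seqP _ _).1 (L_ge v).
pose c0 : color := exist _ 1%N isT.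
pose s := c0 :: flatten [seq l v | v <- enum V].
pose d : seq_sub s := SeqSub (mem_head _ _).
pose L' v := [set c : seq_sub s | ssval c \in l v]%SET.
apply/card_at_least_seqP.
exists [seq color_of phi | phi in good d G H L' [set: V]].
split.
- by rewrite map_inj_uniq ?enum_uniq //; apply: color_of_inj.
- move=> _ /mapP[phi + ->]; rewrite mem_enum => /color_of_good[pcf lphi].
  split=> // x; rewrite ffunE; case: (lP x) => _ lL _; apply: lL.
  by have := lphi x; rewrite inE.
- rewrite size_map -cardE; apply: (card_good_ge R_gt0 beta_ge0) => //.
    by move=> *; apply: conflict_le.
  move=> v; case: (lP v) => ul _ /le_trans-> //; rewrite ler_nat cardE.
  rewrite -(size_map (@ssval _ s)); apply: uniq_leq_size => // c cl.
  have cs : c \in s.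
    rewrite inE; apply/orP; right.
    by apply/flatten_mapP; exists v => //; rewrite mem_enum.
  by apply/mapP; exists (SeqSub cs) => //; rewrite mem_enum inE.
Qed.

(** * The two bounds on the list sizes *)

Theorem theorem5 (K : realType) (r eps R : K)
    (r_gt0 : 0 < r) (eps_gt0 : 0 < eps) (R_gt0 : 0 < R)
    (V : finType) (G : sgraph V) (H : hypergraph V)
    (rankH : (hrank H)%:R <= r)
    (edge_ge3 : forall f : {set V}, f \in hedges H -> (3 <= #|f|)%N)
    (a : int)
    (Ha : ((1 + 1 / eps) * r <= R /\
           a = Num.ceil ((max_deg G)%:R + R + (1 + eps) * max_hterm H r R))
          \/
          (r <= 4 /\
           a = Num.ceil ((max_deg G)%:R + R
                         + (max_hdeg H)%:R * (3 * R^-1 + R ^- 2))))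
    (L : V -> set color)
    (HL : assignment (a%:~R : K) L) :
  card_at_least (R ^+ #|V|)
    [set phi | proper_conflict_free G H phi /\ L_coloring L phi]%classic.
Proof.
have card_le_r f : f \in hedges H -> #|f|%:R <= r.
  by move=> fH; apply: le_trans rankH; rewrite ler_nat; apply: leq_bigmax_cond.
have degD v : (deg G v)%:R <= (max_deg G)%:R :> K by rewrite ler_nat leq_bigmax.
have weaken (beta : V -> K) b :
    a = Num.ceil ((max_deg G)%:R + R + b) ->
    (forall v, (hdeg H v)%:R * beta v <= b) ->
    forall v, card_at_least ((deg G v)%:R + R + (hdeg H v)%:R * beta v) (L v).
  move=> ea le_b v; have [n [an nL]] := HL v; exists n; split=> //.
  apply: le_trans an; rewrite ea; apply: le_trans (ceil_ge _).
  by rewrite !lerD ?degD ?lexx.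
case: Ha => [[rR ea]|[r4 ea]].
  pose beta v := r ^+ uphalf (mr H v) * R ^ (1 - (uphalf (mr H v))%:Z).
  have beta_ge0 v : 0 <= beta v by rewrite mulr_ge0 ?exprn_ge0 ?exprz_ge0 ?ltW.
  have hterm_le v : hterm H r R v <= max_hterm H r R by apply: le_bigmax.
  have max_ge0 : 0 <= max_hterm H r R by apply: bigmax_ge_id.
  apply: (proper_conflict_free_colorings R_gt0 beta_ge0); last first.
    apply: weaken ea _ => v; apply: le_trans (hterm_le v) _.
    by rewrite ler_peMl // lerDl ltW.
  move=> D d L' S v f fH vf fS gS.
  have rR1 : r <= R.
    apply: le_trans rR; rewrite ler_peMl ?(ltW r_gt0) //.
    by rewrite lerDl divr_ge0 // ltW.
  have x0 : 0 <= r / R by rewrite divr_ge0 ?ltW.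
  have x1 : r / R <= 1 by rewrite ler_pdivrMr // mul1r.
  have fx : #|f|%:R <= r / R * R by rewrite divfK ?gt_eqF ?card_le_r.
  apply: le_trans (conflicting_bound R_gt0 gS fS x0 x1 fx vf) _.
  rewrite mulrA; apply: ler_wpM2r; first exact: ler0n.
  have -> : beta v = (r / R) ^+ uphalf (mr H v) * R.
    rewrite /beta expfzDr ?gt_eqF // expr1z exprMn mulrA mulrAC.
    by rewrite exprVn -exprnN.
  apply: ler_wpM2r; first exact: ltW.
  by apply: ler_wiXn2l => //; apply: uphalf_leq; apply: mr_le_card.
pose beta (v : V) := 3 * R^-1.
have beta_ge0 v : 0 <= beta v by rewrite mulr_ge0 ?invr_ge0 ?ltW.
apply: (proper_conflict_free_colorings R_gt0 beta_ge0); last first.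
  apply: weaken ea _ => v; apply: ler_pM; rewrite ?beta_ge0 //.
    by rewrite ler_nat leq_bigmax.
  by rewrite lerDl invr_ge0 exprn_ge0 ?ltW.
move=> D d L' S v f fH vf fS gS.
apply: conflicting_bound_small => //; rewrite edge_ge3 //= -(ler_nat K).
exact: le_trans (card_le_r _ fH) r4.
Qed.
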